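(* Consider a finite graph with non-empty finite vertex set $X$, given by a symmetric map $b : X \times X \to [0,\infty)$ with $b(x,x)=0$ for all $x\in X$, and let $A \in \mathbb{C}^{|X| \times |X|}$ be its adjacency matrix. Let $V \in \mathbb{R}^{|X| \times |X|}$ be a diagonal matrix. Then $A+V$ and $A$ are isospectral if and only if $V=0$.
   Context: Two vertices $x,y \in X$ are connected by an edge if and only if $b(x,y) \neq 0$; in particular the graph has no loops. The adjacency matrix $A$ is the Hermitian matrix with rows and columns indexed by $X$ such that $A_{x,y}=1$ if $b(x,y)\neq 0$ and $A_{x,y}=0$ otherwise. Two Hermitian matrices of the same size are called isospectral if and only if they have the same eigenvalues, counted with multiplicities. *)

(* Defs.v *)
From mathcomp Require Import all_boot all_order all_algebra.
From mathcomp Require Import reals.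
From mathcomp.real_closed Require Import complex.
Set Implicit Arguments.
Unset Strict Implicit.
Unset Printing Implicit Defensive.
Import Order.TTheory GRing.Theory Num.Theory.
Local Open Scope ring_scope.
Local Open Scope complex_scope.

Definition edge (R : realType) (X : finType) (b : X -> X -> R) : rel X :=
  fun x y => b x y != 0.

(* Rows and columns are indexed by X through its canonical enumeration. *)
Definition adjacency_mx (R : realType) (X : finType) (b : X -> X -> R) :
    'M[R[i]]_#|X| :=
  \matrix_(i, j) (edge b (enum_val i) (enum_val j))%:R.

(* Algebraic multiplicity; for Hermitian matrices it coincides with the
   dimension of the eigenspace. *)
Definition eigenvalue_mult (F : fieldType) (n : nat) (M : 'M[F]_n) (a : F) :
    nat := mup a (char_poly M).

Definition isospectral (F : fieldType) (n : nat) (M N : 'M[F]_n) : Prop :=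
  eigenvalue M =1 eigenvalue N /\
  forall a : F, eigenvalue M a -> eigenvalue_mult M a = eigenvalue_mult N a.

(* Main.v *)
Require Import Defs.
From mathcomp Require Import all_boot all_order all_algebra.
From mathcomp Require Import reals.
From mathcomp.real_closed Require Import complex.
Set Implicit Arguments.
Unset Strict Implicit.
Unset Printing Implicit Defensive.
Import Order.TTheory GRing.Theory Num.Theory.
Local Open Scope ring_scope.
Local Open Scope complex_scope.

(** The second moment of the spectrum decides the question. If [A + V] and [A]
    are isospectral, the traces of their squares agree. Expanding,
    [\tr ((A + V)^2) = \tr (A^2) + 2 \tr (A V) + \tr (V^2)], and the cross term
    vanishes because [V] is diagonal while the diagonal of [A] is zero (no
    loops). Hence [\tr (V^2)], the sum of the squares of the real diagonal
    entries of [V], is zero, and so is [V].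

    That the spectrum determines [\tr (M^2)] is obtained from characteristic
    polynomials. Over an algebraically closed field, eigenvalues and
    multiplicities determine the characteristic polynomial
    ([isospectral_char_poly]). Up to sign, the product of [char_poly M] at [X]
    and at [-X] is [char_poly (M^2)] at [X^2] ([char_poly_sqr]), so
    [char_poly M] determines [char_poly (M^2)], one coefficient of which is
    [- \tr (M^2)] ([char_poly_eq_mxtrace_sqr]). *)

(** A monic polynomial over an algebraically closed field is the product of its
    linear factors, so it is recovered from its root multiplicities. *)
Lemma monic_eq_mup (F : closedFieldType) (p q : {poly F}) :
  p \is monic -> q \is monic -> (forall a, mup a p = mup a q) -> p = q.
Proof.
have [r ->] := closed_field_poly_normal p.
have [s ->] := closed_field_poly_normal q.
rewrite !monicE !lead_coefZ !(monicP (monic_prod_XsubC _ _ _)) !mulr1.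
move=> /eqP-> /eqP->; rewrite !scale1r => eq_mup.
apply/perm_big/allP => a _ /=.
by rewrite -!mu_prod_XsubC eq_mup.
Qed.

Lemma isospectral_char_poly (F : closedFieldType) (n : nat) (M N : 'M[F]_n) :
  isospectral M N -> char_poly M = char_poly N.
Proof.
move=> [eq_eig eq_mult]; apply: monic_eq_mup; try exact: char_poly_monic.
move=> a; have [/eq_mult//|not_eig] := boolP (eigenvalue M a).
by rewrite !mupNroot // -eigenvalue_root_char -?eq_eig.
Qed.

(** This is the determinant of [(X - M) (X + M) = X^2 - M^2]. The second factor
    is [- (- X - M)], which accounts for the sign. *)
Lemma char_poly_sqr (R : comNzRingType) (n : nat) (M : 'M[R]_n) :
  char_poly (M *m M) \Po 'X^2 =
  (-1) ^+ n * (char_poly M * (char_poly M \Po (- 'X))).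
Proof.
have map_subst (N : 'M[R]_n) (q : {poly R}) :
    map_mx (comp_poly q) (char_poly_mx N) = q%:M - map_mx polyC N.
  apply/matrixP => i j; rewrite !mxE comp_polyB comp_polyC.
  by rewrite rmorphMn /= comp_polyX.
rewrite /char_poly -!det_map_mx !map_subst mulrCA -detZ -det_mulmx.
rewrite scaleN1r opprB raddfN /= opprK /char_poly_mx; congr (\det _).
rewrite mulmxDr !mulmxBl -(scalar_mxC 'X) [RHS]addrC addrA subrK.
by rewrite -scalar_mxM map_mxM expr2.
Qed.

Lemma char_poly_eq_mxtrace_sqr (R : comNzRingType) (n : nat) (M N : 'M[R]_n) :
  char_poly M = char_poly N -> \tr (M *m M) = \tr (N *m N).
Proof.
case: n M N => [|n] M N eqMN; first by rewrite /mxtrace !big_ord0.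
have := char_poly_sqr M; rewrite eqMN -char_poly_sqr.
(* Composing with [X^2] doubles exponents: the trace sits in degree [n], one
   below the size [n.+1] of the matrix, and moves to degree [n * 2]. *)
move=> /(congr1 (fun p : {poly R} => p`_(n * 2)%N)).
rewrite !coef_comp_poly_Xn // dvdn_mull // mulnK //.
by rewrite !(char_poly_trace _ (ltn0Sn n)) => /oppr_inj.
Qed.

(** Only the diagonal entries of [A] contribute to [\tr (A *m diag_mx d)], so
    both cross terms vanish. *)
Lemma mxtrace_sqrD_diag (R : comNzRingType) (n : nat)
    (A : 'M[R]_n) (d : 'rV[R]_n) :
  (forall i, A i i = 0) ->
  \tr ((A + diag_mx d) *m (A + diag_mx d)) =
  \tr (A *m A) + \sum_i d 0 i ^+ 2.
Proof.
move=> A0; have trAD : \tr (A *m diag_mx d) = 0.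
  by apply: big1 => i _; rewrite mul_mx_diag mxE A0 mul0r.
rewrite mulmxDr !mulmxDl !mxtraceD [\tr (diag_mx d *m A)]mxtrace_mulC trAD.
rewrite addr0 add0r; congr (_ + _).
by apply: eq_bigr => i _; rewrite mul_mx_diag !mxE eqxx mulr1n expr2.
Qed.

Theorem theorem10 (R : realType) (X : finType) (hX : (0 < #|X|)%N)
    (b : X -> X -> R)
    (b_ge0 : forall x y : X, 0 <= b x y)
    (b_sym : forall x y : X, b x y = b y x)
    (b_diag : forall x : X, b x x = 0)
    (V : 'M[R]_#|X|) (hV : is_diag_mx V) :
  isospectral (adjacency_mx b + map_mx (real_complex R) V) (adjacency_mx b)
  <-> V = 0.
Proof.
split=> [iso|->]; last by rewrite map_mx0 addr0; split.
have /diag_mxP[d defV] := hV; rewrite {}defV in iso *.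
have A0 i : adjacency_mx b i i = 0 by rewrite mxE /edge b_diag eqxx.
have /char_poly_eq_mxtrace_sqr := isospectral_char_poly iso.
rewrite map_diag_mx mxtrace_sqrD_diag // => /eqP.
rewrite -subr_eq0 addrC addKr.
(* Back to the reals, where a vanishing sum of squares has vanishing terms. *)
under eq_bigr do rewrite mxE -rmorphXn.
rewrite -rmorph_sum fmorph_eq0 psumr_eq0 => [/allP d0|i _]; last exact: sqr_ge0.
suff -> : d = 0 by rewrite raddf0.
apply/rowP => i; rewrite mxE; apply/eqP.
by rewrite -sqrf_eq0; apply: d0; rewrite mem_index_enum.
Qed.
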